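(* Let $P,Q\in\mathbb{F}_{q^r}[X,\sigma]$ be two monic, nonconstant polynomials. Then $\Psi(PQ)=\Psi(P)\Psi(Q)$.
   Context: Let $p$ be a prime, $q=p^a$, $r\ge1$, $\sigma(x)=x^q$ on $\mathbb{F}_{q^r}$. $\mathbb{F}_{q^r}[X,\sigma]$ is the skew polynomial ring with $X\cdot c=\sigma(c)\cdot X$ for $c\in\mathbb{F}_{q^r}$. For monic $P=X^d-\sum_{i=0}^{d-1}a_iX^i$, let $D_P=\bigoplus_{i=0}^{d-1}\mathbb{F}_{q^r}e_i$ with the $\sigma$-semi-linear map $\varphi$ given by $\varphi(e_i)=e_{i+1}$ for $0\le i\le d-2$ and $\varphi(e_{d-1})=\sum_{i=0}^{d-1}a_ie_i$. Then $\varphi^r$ is $\mathbb{F}_{q^r}$-linear, and $\Psi(P)=\det(Y\,\mathrm{id}-\varphi^r)$, its characteristic polynomial, which lies in $\mathbb{F}_q[Y]$ (commutative polynomials). *)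

(* Defs.v *)
From HB Require Import structures.
From mathcomp Require Import all_boot all_algebra all_field.

Set Implicit Arguments.
Unset Strict Implicit.
Unset Printing Implicit Defensive.

Import GRing.Theory.
Local Open Scope ring_scope.

(* An element \sum_i a_i X^i of the skew polynomial ring R[X, sigma], scalars
   on the left, is encoded by the ordinary polynomial with coefficients a_i.
   The wrapper keeps the skew product apart from the product of {poly R}. *)
Record skew_poly (R : nzRingType) (sigma : {rmorphism R -> R}) :=
  SkewPoly { skew_val : {poly R} }.
Arguments SkewPoly {R} sigma skew_val.

HB.instance Definition _ (R : nzRingType) (sigma : {rmorphism R -> R}) :=
  [isNew for @skew_val R sigma].
HB.instance Definition _ (R : nzRingType) (sigma : {rmorphism R -> R}) :=
  [Choice of skew_poly sigma by <:].

Section SkewPolyRing.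

Variables (R : nzRingType) (sigma : {rmorphism R -> R}).
Implicit Types (P Q S : skew_poly sigma) (c : R).

Local Notation "''s_' i" := (iter i sigma) (at level 8, i at level 2).

Definition skew_const c : skew_poly sigma := SkewPoly sigma c%:P.
Definition skew_X : skew_poly sigma := SkewPoly sigma 'X.

Definition skew_add P Q := SkewPoly sigma (skew_val P + skew_val Q).
Definition skew_opp P := SkewPoly sigma (- skew_val P).

(* From X^i b = sigma^i(b) X^i. *)
Definition skew_mul P Q :=
  let p := skew_val P in let q := skew_val Q in
  SkewPoly sigma (\poly_(k < (size p + size q).-1)
                    \sum_(i < k.+1) p`_i * 's_i q`_(k - i)).

Lemma skew_val_inj : injective (@skew_val R sigma).
Proof. exact: val_inj. Qed.

Fact skew_addA : associative skew_add.
Proof. by move=> P Q S; apply: skew_val_inj; rewrite /= addrA. Qed.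

Fact skew_addC : commutative skew_add.
Proof. by move=> P Q; apply: skew_val_inj; rewrite /= addrC. Qed.

Fact skew_add0 : left_id (skew_const 0) skew_add.
Proof. by move=> P; apply: skew_val_inj; rewrite /= polyC0 add0r. Qed.

Fact skew_addN : left_inverse (skew_const 0) skew_opp skew_add.
Proof. by move=> P; apply: skew_val_inj; rewrite /= polyC0 addNr. Qed.

HB.instance Definition _ := GRing.isZmodule.Build (skew_poly sigma)
  skew_addA skew_addC skew_add0 skew_addN.

Lemma iter_rmorph0 i : 's_i 0 = 0.
Proof. by elim: i => //= i ->; rewrite rmorph0. Qed.

Lemma iter_rmorph1 i : 's_i 1 = 1.
Proof. by elim: i => //= i ->; rewrite rmorph1. Qed.

Lemma iter_rmorphD i : {morph 's_i : x y / x + y}.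
Proof. by elim: i => //= i IHi x y; rewrite /= IHi rmorphD. Qed.

Lemma iter_rmorphM i : {morph 's_i : x y / x * y}.
Proof. by elim: i => //= i IHi x y; rewrite /= IHi rmorphM. Qed.

Lemma iter_rmorph_sum i n (F : 'I_n -> R) :
  's_i (\sum_(j < n) F j) = \sum_(j < n) 's_i (F j).
Proof. exact: (big_morph _ (iter_rmorphD i) (iter_rmorph0 i)). Qed.

Lemma coef_skew_add P Q k : (skew_val (skew_add P Q))`_k =
  (skew_val P)`_k + (skew_val Q)`_k.
Proof. exact: coefD. Qed.

Lemma coef_skew_mul P Q k : (skew_val (skew_mul P Q))`_k =
  \sum_(i < k.+1) (skew_val P)`_i * 's_i (skew_val Q)`_(k - i).
Proof.
rewrite /skew_mul /= coef_poly ltn_predRL; case: leqP => // le_pq_k1.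
rewrite big1 // => i _; have [le_p_i|lt_i_p] := leqP (size (skew_val P)) i.
  by rewrite nth_default ?mul0r.
rewrite [(skew_val Q)`__]nth_default ?iter_rmorph0 ?mulr0 //.
rewrite leq_subRL -ltnS //.
by rewrite (leq_trans _ le_pq_k1) // ltn_add2r.
Qed.

Lemma coef_skew_mul_rev P Q k : (skew_val (skew_mul P Q))`_k =
  \sum_(j < k.+1) (skew_val P)`_(k - j) * 's_(k - j) (skew_val Q)`_j.
Proof.
rewrite coef_skew_mul (reindex_inj rev_ord_inj) /=.
by apply: eq_bigr => j _; rewrite (sub_ordK j).
Qed.

Fact skew_mulA : associative skew_mul.
Proof.
move=> P Q S; apply/skew_val_inj/polyP => i.
rewrite coef_skew_mul coef_skew_mul_rev.
pose coef3 j k := (skew_val P)`_j *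
  ('s_j (skew_val Q)`_(i - j - k) * 's_(i - k) (skew_val S)`_k).
transitivity (\sum_(j < i.+1) \sum_(k < i.+1 | (k <= i - j)%N) coef3 j k).
  apply: eq_bigr => /= j _.
  rewrite coef_skew_mul_rev iter_rmorph_sum big_distrr /=.
  rewrite (big_ord_narrow_leq (leq_subr _ _)); apply: eq_bigr => k _ /=.
  rewrite /coef3 iter_rmorphM -iterD.
  have le_ji : (j <= i)%N := leq_ord j; have le_k : (k <= i - j)%N := leq_ord k.
  have le_ki : (k <= i)%N := leq_trans le_k (leq_subr j i).
  by rewrite subnAC subnKC // leq_subRL // addnC -leq_subRL.
rewrite (exchange_big_dep predT) //=; apply: eq_bigr => k _.
transitivity (\sum_(j < i.+1 | (j <= i - k)%N) coef3 j k).
  apply: eq_bigl => j; rewrite -ltnS -(ltnS j) -!subSn ?leq_ord //.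
  by rewrite -subn_gt0 -(subn_gt0 j) -!subnDA addnC.
rewrite (big_ord_narrow_leq (leq_subr _ _)) coef_skew_mul big_distrl /=.
by apply: eq_bigr => j _; rewrite /coef3 -!subnDA addnC mulrA.
Qed.

Fact skew_mul1l : left_id (skew_const 1) skew_mul.
Proof.
move=> P; apply/skew_val_inj/polyP => k.
rewrite coef_skew_mul big_ord_recl subn0 /= coefC /= mul1r.
by rewrite big1 ?addr0 // => j _; rewrite coefC mul0r.
Qed.

Fact skew_mul1r : right_id (skew_const 1) skew_mul.
Proof.
move=> P; apply/skew_val_inj/polyP => k.
rewrite coef_skew_mul_rev big_ord_recl subn0 /= coefC /= iter_rmorph1 mulr1.
by rewrite big1 ?addr0 // => j _; rewrite coefC /= iter_rmorph0 mulr0.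
Qed.

Fact skew_mulDl : left_distributive skew_mul skew_add.
Proof.
move=> P Q S; apply/skew_val_inj/polyP => k.
rewrite coef_skew_add !coef_skew_mul -big_split.
by apply: eq_bigr => j _; rewrite coef_skew_add mulrDl.
Qed.

Fact skew_mulDr : right_distributive skew_mul skew_add.
Proof.
move=> P Q S; apply/skew_val_inj/polyP => k.
rewrite coef_skew_add !coef_skew_mul -big_split.
by apply: eq_bigr => j _; rewrite coef_skew_add iter_rmorphD mulrDr.
Qed.

Fact skew_1neq0 : skew_const 1 != skew_const 0.
Proof. by rewrite -(inj_eq skew_val_inj) /= polyC0 polyC1 oner_neq0. Qed.

HB.instance Definition _ := GRing.Zmodule_isNzRing.Build (skew_poly sigma)
  skew_mulA skew_mul1l skew_mul1r skew_mulDl skew_mulDr skew_1neq0.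

Lemma skew_XC c : skew_X * skew_const c = skew_const (sigma c) * skew_X.
Proof.
apply/skew_val_inj/polyP => k; rewrite !coef_skew_mul !big_ord_recl /= subn0.
rewrite coefX mul0r add0r coefC /= coefX.
rewrite [X in _ = _ + X]big1 ?addr0 => [|i _]; last by rewrite coefC mul0r.
case: k => [|k]; first by rewrite big_ord0 mulr0.
rewrite big_ord_recl /= coefX /= mul1r big1 ?addr0 => [|i _].
  by rewrite coefC subn_eq0 /=; case: k => [|k] /=; rewrite ?mulr1 // rmorph0 mulr0.
by rewrite coefX mul0r.
Qed.

Definition skew_deg P : nat := (size (skew_val P)).-1.
Definition skew_monic P : Prop := skew_val P \is monic.
Definition skew_nonconstant P : Prop := (0 < skew_deg P)%N.

End SkewPolyRing.

Section Psi.

Variables (R : comNzRingType) (sigma : {rmorphism R -> R}).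
Implicit Type P : skew_poly sigma.

(* D_P is 'rV[R]_d with d = skew_deg P and e_i = delta_mx 0 i. Row i of the
   companion matrix holds the coordinates of phi(e_i): it is e_(i+1) for
   i < d - 1, and (a_0, ..., a_(d-1)) for i = d - 1, where a_j is minus the
   j-th coefficient of P. *)
Definition skew_phi P (v : 'rV[R]_(skew_deg P)) : 'rV[R]_(skew_deg P) :=
  map_mx sigma v *m companionmx (skew_val P).

Lemma skew_phiD P : {morph skew_phi (P := P) : u v / u + v}.
Proof. by move=> u v; rewrite /skew_phi map_mxD mulmxDl. Qed.

Lemma skew_phiZ P c (v : 'rV[R]_(skew_deg P)) :
  skew_phi (c *: v) = sigma c *: skew_phi v.
Proof. by rewrite /skew_phi map_mxZ -scalemxAl. Qed.

Lemma skew_phi_delta P (i j : 'I_(skew_deg P)) :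
  j = i.+1 :> nat -> skew_phi (delta_mx 0 i) = delta_mx 0 j.
Proof.
move=> ji; have lt_i : (i < (skew_deg P).-1)%N by rewrite ltn_predRL -ji.
rewrite /skew_phi map_delta_mx -rowE; apply/rowP => k; rewrite !mxE eqxx /=.
by rewrite (ltn_eqF lt_i) -ji eq_sym.
Qed.

Lemma skew_phi_last P (i : 'I_(skew_deg P)) : i = (skew_deg P).-1 :> nat ->
  skew_phi (delta_mx 0 i) =
    \sum_(j < skew_deg P) (- (skew_val P)`_j) *: delta_mx 0 j.
Proof.
move=> iE; rewrite /skew_phi map_delta_mx -rowE.
rewrite [LHS]row_sum_delta; apply: eq_bigr => j _.
by rewrite !mxE iE eqxx.
Qed.

Lemma iter_skew_phi_linear r P c (u v : 'rV[R]_(skew_deg P)) :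
  (forall x, iter r sigma x = x) ->
  iter r (@skew_phi P) (c *: u + v) =
    c *: iter r (@skew_phi P) u + iter r (@skew_phi P) v.
Proof.
move=> sr; rewrite -{2}(sr c); elim: {sr} r => //= r ->.
by rewrite skew_phiD skew_phiZ.
Qed.

(* char_poly A is \det ('X%:M - A), and lin1_mx is the matrix, acting on row
   vectors, of the map phi^r, which is linear when sigma^r = id. *)
Definition Psi (r : nat) P : {poly R} :=
  char_poly (lin1_mx (iter r (@skew_phi P))).

End Psi.

Lemma card_pchar (p a r : nat) (L : finFieldType) :
  prime p -> #|L| = ((p ^ a) ^ r)%N -> p \in [pchar L].
Proof. by rewrite -expnM => p_pr cardL; exact: (card_finPcharP cardL). Qed.

(* The two proof arguments are what makes this function a ring morphism. *)
Definition qfrob (p a r : nat) (L : finFieldType) (p_prime : prime p)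
  (cardL : #|L| = ((p ^ a) ^ r)%N) (x : L) : L := x ^+ (p ^ a).

Section QFrobenius.

Variables (p a r : nat) (L : finFieldType) (p_prime : prime p).
Variable cardL : #|L| = ((p ^ a) ^ r)%N.

Fact qfrob_is_zmod_morphism : zmod_morphism (qfrob p_prime cardL).
Proof.
have charL := card_pchar p_prime cardL.
have pn : [pchar L].-nat (p ^ a)%N by rewrite pnatX pnatE ?charL.
by move=> x y; rewrite /qfrob -{2}(subrK y x) (exprDn_pchar (x - y)) ?addrK.
Qed.

Fact qfrob_is_monoid_morphism : monoid_morphism (qfrob p_prime cardL).
Proof. by split=> [|x y]; rewrite /qfrob ?expr1n ?exprMn. Qed.

HB.instance Definition _ := GRing.isZmodMorphism.Build L L
  (qfrob p_prime cardL) qfrob_is_zmod_morphism.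
HB.instance Definition _ := GRing.isMonoidMorphism.Build L L
  (qfrob p_prime cardL) qfrob_is_monoid_morphism.

Lemma iter_qfrob x : iter r (qfrob p_prime cardL) x = x.
Proof.
suff iterE n : iter n (qfrob p_prime cardL) x = x ^+ ((p ^ a) ^ n).
  by rewrite iterE -cardL expf_card.
by elim: n => [|n IHn]; rewrite ?expr1 //= IHn /qfrob -exprM -expnSr.
Qed.

End QFrobenius.

(* Main.v *)
(* Right multiplication by Q embeds D_P = R[X,sigma]/(P) in D_{PQ}, with
   quotient D_Q, compatibly with phi. In the basis 1, X, ..., X^(e-1), Q, XQ,
   ..., X^(d-1)Q of D_{PQ}, where d = deg P and e = deg Q, the map phi^r is
   therefore block triangular, its diagonal blocks being the matrices of phi^r
   on D_Q and D_P. The base change matrix S is unitriangular, and phi^r becomes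
   sigma^r(S) A S^-1 = S A S^-1. *)
Require Import Defs.
From mathcomp Require Import all_boot all_algebra all_field.

Set Implicit Arguments.
Unset Strict Implicit.
Unset Printing Implicit Defensive.

Import GRing.Theory.
Local Open Scope ring_scope.

(** * Characteristic polynomials under block triangular shape and conjugation *)

Section CharPoly.

Variable R : comNzRingType.

Lemma char_poly_ublock m n (A : 'M[R]_m) (B : 'M_(m, n)) (C : 'M_n) :
  char_poly (block_mx A B 0 C) = char_poly A * char_poly C.
Proof.
rewrite /char_poly /char_poly_mx map_block_mx map_mx0 scalar_mx_block.
by rewrite opp_block_mx add_block_mx oppr0 addr0 det_ublock.
Qed.

(** Determinants of the intertwining relation, lifted to matrices over [{poly R}], are compared; as
    [\det S = 1], no inverse of [S] is formed. *)
Lemma char_poly_conj n (S A B : 'M[R]_n) :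
  \det S = 1 -> S *m A = B *m S -> char_poly A = char_poly B.
Proof.
move=> detS SA; pose SX := map_mx polyC S.
have detSX : \det SX = 1 by rewrite det_map_mx detS.
have: SX *m char_poly_mx A = char_poly_mx B *m SX.
  by rewrite mulmxBr mulmxBl -!map_mxM SA scalar_mxC.
move/(congr1 determinant); rewrite !det_mulmx detSX mul1r mulr1.
exact.
Qed.

End CharPoly.

Lemma poly_expand (R : nzRingType) n (p : {poly R}) : (size p <= n)%N ->
  p = \sum_(i < n) p`_i *: 'X^i.
Proof.
move=> le_p_n; rewrite -poly_def; apply/polyP => k; rewrite coef_poly.
by case: ltnP => // le_nk; rewrite nth_default // (leq_trans le_p_n).
Qed.

(** * Products, degrees and monicity in the skew polynomial ring *)

Section SkewPolyFacts.

Variables (R : nzRingType) (sigma : {rmorphism R -> R}).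
Implicit Types (P Q A : skew_poly sigma) (p : {poly R}).

Lemma skew_val0 : skew_val (0 : skew_poly sigma) = 0.
Proof. exact: polyC0. Qed.

Lemma skew_valD P Q : skew_val (P + Q) = skew_val P + skew_val Q.
Proof. by []. Qed.

Lemma skew_val_sum n (F : 'I_n -> skew_poly sigma) :
  skew_val (\sum_(i < n) F i) = \sum_(i < n) skew_val (F i).
Proof. exact: (big_morph _ skew_valD skew_val0). Qed.

Lemma skew_val_constM c A : skew_val (skew_const sigma c * A) = c *: skew_val A.
Proof.
apply/polyP => k; rewrite coef_skew_mul coefZ big_ord_recl /= subn0 coefC /=.
by rewrite big1 ?addr0 // => j _; rewrite coefC mul0r.
Qed.

Lemma skew_val_XM A :
  skew_val (skew_X sigma * A) = map_poly sigma (skew_val A) * 'X.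
Proof.
apply/polyP => k; rewrite coef_skew_mul coefMX coef_map.
rewrite big_ord_recl /= coefX mul0r add0r.
case: k => [|k]; first by rewrite big_ord0.
rewrite big_ord_recl /= coefX mul1r subSS subn0.
by rewrite big1 ?addr0 // => j _; rewrite coefX mul0r.
Qed.

Lemma skew_val_Xn n : skew_val (skew_X sigma ^+ n) = 'X^n.
Proof.
elim: n => [|n IHn]; first by rewrite /= polyC1.
by rewrite exprS skew_val_XM IHn map_polyXn exprSr.
Qed.

Lemma skew_polyM_expand n p A : (size p <= n)%N ->
  skew_val (SkewPoly sigma p * A) =
    \sum_(i < n) p`_i *: skew_val (skew_X sigma ^+ i * A).
Proof.
move=> le_p_n; have -> : SkewPoly sigma p =
    \sum_(i < n) skew_const sigma p`_i * skew_X sigma ^+ i.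
  apply: skew_val_inj; rewrite skew_val_sum [LHS](poly_expand le_p_n).
  by apply: eq_bigr => i _; rewrite skew_val_constM skew_val_Xn.
rewrite mulr_suml skew_val_sum.
by apply: eq_bigr => i _; rewrite -mulrA skew_val_constM.
Qed.

(** Left multiplication by [X] applies [sigma] to the coefficients and shifts them; the leading
    coefficient 1 is fixed by [sigma], so it survives. *)
Lemma skew_monic_XnM n A : skew_monic A ->
  skew_monic (skew_X sigma ^+ n * A) /\
  size (skew_val (skew_X sigma ^+ n * A)) = (n + size (skew_val A))%N.
Proof.
move=> A_mon; elim: n => [|n [IHm IHs]]; first by rewrite expr0 mul1r.
have map_mon := monic_map sigma IHm; rewrite exprS -mulrA /skew_monic.
rewrite skew_val_XM; split; first by rewrite rpredM ?monicX.
rewrite size_mulX ?monic_neq0 // size_map_poly_id0 ?IHs //.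
by rewrite (monicP IHm) rmorph1 oner_neq0.
Qed.

(** In the expansion of [P * Q] along the [X^i * Q], the top term [X^d * Q] is monic and dominates
    all others in degree. *)
Lemma skew_monicM P Q : skew_monic P -> skew_monic Q ->
  skew_monic (P * Q) /\ skew_deg (P * Q) = (skew_deg P + skew_deg Q)%N.
Proof.
case: P => p p_mon Q_mon; rewrite /skew_deg -[skew_val (SkewPoly sigma p)]/p.
have sz_p : size p = (size p).-1.+1 by rewrite -polySpred ?monic_neq0.
have sz_Q : size (skew_val Q) = (size (skew_val Q)).-1.+1.
  by rewrite -polySpred ?monic_neq0.
set d := (size p).-1 in sz_p *; set e := (size (skew_val Q)).-1 in sz_Q *.
have [XQ_mon XQ_size] := skew_monic_XnM d Q_mon.
pose p1 := \sum_(i < d) p`_i *: skew_val (skew_X sigma ^+ i * Q).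
have p_d : p`_d = 1 by have /monicP := p_mon; rewrite lead_coefE.
have PQ_eq : skew_val (SkewPoly sigma p * Q) =
    skew_val (skew_X sigma ^+ d * Q) + p1.
  have le_p : (size p <= d.+1)%N by rewrite sz_p.
  by rewrite (skew_polyM_expand _ le_p) big_ord_recr p_d scale1r addrC.
have lt_p1 : (size p1 < size (skew_val (skew_X sigma ^+ d * Q)%R))%N.
  rewrite XQ_size sz_Q addnS ltnS (leq_trans (size_sum _ _ _)) //.
  apply/bigmax_leqP => i _; apply: leq_trans (size_scale_leq _ _) _.
  have [_ ->] := skew_monic_XnM i Q_mon.
  by rewrite sz_Q addnS -addSn leq_add2r.
split; first by rewrite /skew_monic PQ_eq monicE lead_coefDl // -monicE.
rewrite PQ_eq.
by rewrite size_polyDl // XQ_size sz_Q addnS.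
Qed.

End SkewPolyFacts.

(** * Matrices of iterated semilinear maps *)

Section TwistedNorm.

Variables (R : nzRingType) (sigma : {rmorphism R -> R}).

(* The matrix sigma^(k-1)(C) ... sigma(C) C of the k-th iterate of the
   semilinear map v |-> sigma(v) C. *)
Fixpoint twisted_norm n (C : 'M[R]_n) k : 'M[R]_n :=
  if k is k'.+1 then map_mx sigma (twisted_norm C k') *m C else 1%:M.

Lemma iter_map_mx m n (A : 'M[R]_(m, n)) k i j :
  iter k (map_mx sigma) A i j = iter k sigma (A i j).
Proof. by elim: k => //= k IHk; rewrite mxE IHk. Qed.

Lemma iter_semilinear n (C : 'M[R]_n) k (v : 'rV_n) :
  iter k (fun v => map_mx sigma v *m C) v =
    iter k (map_mx sigma) v *m twisted_norm C k.
Proof.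
elim: k => [|k IHk] /=; first by rewrite mulmx1.
by rewrite IHk map_mxM mulmxA.
Qed.

Lemma lin1_mx_iter_semilinear n (C : 'M[R]_n) k :
  lin1_mx (iter k (fun v => map_mx sigma v *m C)) = twisted_norm C k.
Proof.
apply/row_matrixP => i; rewrite rowE; apply/rowP => j.
rewrite -rowE mxE mxE iter_semilinear.
(* Basis vectors have entries 0 and 1, which [sigma] fixes. *)
suff -> : iter k (map_mx sigma) (delta_mx 0 i) = delta_mx 0 i :> 'rV[R]_n.
  by rewrite -rowE mxE.
by elim: k => //= k ->; rewrite map_delta_mx.
Qed.

(** Semilinear change of basis: [S] moves past one twisted factor at a time, losing one application
    of [sigma] at each. *)
Lemma twisted_norm_conj n (S A B : 'M[R]_n) k :
  map_mx sigma S *m A = B *m S ->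
  iter k (map_mx sigma) S *m twisted_norm A k = twisted_norm B k *m S.
Proof.
move=> SA; elim: k => [|k IHk] /=; first by rewrite mulmx1 mul1mx.
by rewrite mulmxA -map_mxM IHk map_mxM -!mulmxA SA.
Qed.

Lemma twisted_norm_ublock m n (A : 'M[R]_m) (B : 'M_(m, n)) (C : 'M_n) k :
  exists B', twisted_norm (block_mx A B 0 C) k =
    block_mx (twisted_norm A k) B' 0 (twisted_norm C k).
Proof.
elim: k => [|k [B' IHk]] /=; first by exists 0; rewrite scalar_mx_block.
rewrite IHk map_block_mx mulmx_block !map_mx0 !mulmx0 !mul0mx !addr0 add0r.
by eexists.
Qed.

End TwistedNorm.

(** * Companion matrices as multiplication by X followed by reduction *)

Section CompanionOfSize.

Variables (R : nzRingType) (sigma : {rmorphism R -> R}).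

(* [companionmx p] with the dimension as a free parameter, so that
   deg (P Q) = deg Q + deg P can be rewritten in it. *)
Definition companion_n n (p : {poly R}) : 'M[R]_n :=
  \matrix_(i, j) if i == n.-1 :> nat then - p`_j else (i.+1 == j :> nat)%:R.

(** For [p] monic of degree [n], this is the remainder of [X^(i+1)] modulo [p]; a multiple of [p] is
    removed only in the last row. *)
Lemma row_companion_n n p (i : 'I_n) :
  row i (companion_n n p) = poly_rV ('X^(i.+1) - (i.+1 == n)%:R *: p).
Proof.
apply/rowP => j; rewrite !mxE coefB coefXn coefZ.
have -> : (i == n.-1 :> nat) = (i.+1 == n) by case: n i j => [[]|].
case: eqP => [->|_]; first by rewrite (ltn_eqF (ltn_ord j)) mul1r sub0r.
by rewrite mul0r subr0 eq_sym.
Qed.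

Lemma size_companion_row n (p : {poly R}) i :
  p \is monic -> size p = n.+1 -> (i < n)%N ->
  (size ('X^(i.+1) - (i.+1 == n)%:R *: p)%R <= n)%N.
Proof.
move=> p_mon sz_p lt_in; apply/leq_sizeP => k le_nk.
rewrite coefB coefXn coefZ; have [->|ne_in] := eqVneq i.+1 n; last first.
  rewrite mul0r subr0 gtn_eqF //; apply: leq_trans le_nk.
  by rewrite ltn_neqAle ne_in.
move: le_nk; rewrite mul1r leq_eqVlt => /predU1P[<-|lt_nk].
  by have /monicP := p_mon; rewrite lead_coefE sz_p eqxx /= => ->; rewrite subrr.
by rewrite (gtn_eqF lt_nk) nth_default ?subr0 // sz_p.
Qed.

(** The first term on the right is the skew product [X * q]; the second cancels its coefficient of
    degree [n] when [p] is monic of degree [n]. *)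
Lemma semilinear_companion_n n (p q : {poly R}) : (0 < n)%N ->
  map_mx sigma (poly_rV q) *m companion_n n p =
    poly_rV (map_poly sigma q * 'X - sigma q`_n.-1 *: p) :> 'rV[R]_n.
Proof.
move=> n_gt0; rewrite mulmx_sum_row; apply/rowP => j.
rewrite summxE mxE coefB coefMX coefZ coef_map.
under eq_bigr do rewrite row_companion_n !mxE coefB coefXn coefZ mulrBr.
rewrite sumrB; congr (_ - _).
  case: j => [[|j] /= lt_jn].
    by rewrite big1 // => i _; rewrite mulr0.
  rewrite (bigD1 (Ordinal (ltnW lt_jn))) //= eqxx mulr1 big1 ?addr0 // => i.
  by rewrite -val_eqE eq_sym eqSS /= => /negPf->; rewrite mulr0.
have lt_n1 : (n.-1 < n)%N by rewrite prednK.
rewrite (bigD1 (Ordinal lt_n1)) //= prednK // eqxx mul1r big1 ?addr0 // => i.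
rewrite -val_eqE /= -[X in i.+1 == X](prednK n_gt0) eqSS => /negPf->.
by rewrite mul0r mulr0.
Qed.

End CompanionOfSize.

(** * Base change for a product and multiplicativity of [Psi] *)

Section PsiMul.

Variables (R : comNzRingType) (sigma : {rmorphism R -> R}).

Lemma Psi_twisted_norm r (P : skew_poly sigma) n : skew_deg P = n ->
  Psi r P = char_poly (twisted_norm sigma (companion_n n (skew_val P)) r).
Proof. by move=> <-; rewrite -lin1_mx_iter_semilinear. Qed.

Lemma char_poly_twisted_norm_ublock m n
    (A : 'M[R]_m) (B : 'M_(m, n)) (C : 'M_n) k :
  char_poly (twisted_norm sigma (block_mx A B 0 C) k) =
    char_poly (twisted_norm sigma A k) * char_poly (twisted_norm sigma C k).
Proof.
by have [B' ->] := twisted_norm_ublock sigma A B C k; exact: char_poly_ublock.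
Qed.

Variables (P Q : skew_poly sigma) (d e : nat).
Hypotheses (P_mon : skew_monic P) (Q_mon : skew_monic Q).
Hypotheses (degP : skew_deg P = d) (degQ : skew_deg Q = e) (d_gt0 : (0 < d)%N).

Local Notation XQ j := (skew_val (skew_X sigma ^+ j * Q)).

Definition mul_basis : 'M[R]_(e + d) :=
  col_mx (\matrix_(i < e) poly_rV 'X^i) (\matrix_(j < d) poly_rV (XQ j)).

Lemma size_XQ j : size (XQ j) = (e + j).+1.
Proof.
have [_ ->] := skew_monic_XnM j Q_mon.
by rewrite [size _]polySpred ?monic_neq0 // addnS addnC -degQ.
Qed.

Lemma lead_XQ j : (XQ j)`_(e + j) = 1.
Proof.
have [/monicP XQ_mon _] := skew_monic_XnM j Q_mon.
by move: XQ_mon; rewrite lead_coefE size_XQ.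
Qed.

(** Row [i] holds a polynomial of degree [i], so it vanishes beyond the diagonal. *)
Lemma mul_basis_trig : is_trig_mx mul_basis.
Proof.
apply/is_trig_mxP => i j; rewrite -(splitK i).
case: split => i' /= lt_ij; rewrite ?col_mxEu ?col_mxEd !mxE.
  by rewrite coefXn gtn_eqF.
by rewrite nth_default ?size_XQ.
Qed.

Lemma det_mul_basis : \det mul_basis = 1.
Proof.
rewrite (det_trig mul_basis_trig) big1 // => i _.
have [i' ->|i' ->] := split_ordP i; rewrite ?col_mxEu ?col_mxEd mxE mxE /=.
  by rewrite coefXn eqxx.
exact: lead_XQ.
Qed.

(** Coordinates in the new basis are the remainder [u] and the quotient [v] of right division by
    [Q]. *)
Lemma row_mx_mul_basis (u v : {poly R}) : (size u <= e)%N -> (size v <= d)%N ->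
  row_mx (poly_rV u) (poly_rV v) *m mul_basis =
    poly_rV (u + skew_val (SkewPoly sigma v * Q)).
Proof.
move=> le_u_e le_v_d; rewrite mul_row_col !mulmx_sum_row linearD.
congr (_ + _).
  rewrite [in RHS](poly_expand le_u_e) linear_sum; apply: eq_bigr => i _.
  by rewrite linearZ rowK mxE.
rewrite (skew_polyM_expand _ le_v_d) linear_sum; apply: eq_bigr => i _.
by rewrite linearZ rowK mxE.
Qed.

(** Each row computes [X] times a basis element. The corner block records [X^e = (X^e - Q) + 1 * Q],
    the only place where the first [e] basis elements leave their span. *)
Lemma mul_basis_conj :
  map_mx sigma mul_basis *m companion_n (e + d) (skew_val (P * Q)) =
  block_mx (companion_n e (skew_val Q))
           (\matrix_(i < e) poly_rV (i.+1 == e)%:R%:P)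
           0 (companion_n d (skew_val P)) *m mul_basis.
Proof.
have sz_P : size (skew_val P) = d.+1.
  by rewrite -degP -polySpred ?monic_neq0.
have sz_Q : size (skew_val Q) = e.+1.
  by rewrite -degQ -polySpred ?monic_neq0.
have ed_gt0 : (0 < e + d)%N by rewrite addn_gt0 d_gt0 orbT.
apply/row_matrixP => i; rewrite !row_mul -map_row.
have [k ->|k ->] := split_ordP i.
  rewrite /block_mx !rowKu row_row_mx !rowK row_companion_n.
  rewrite semilinear_companion_n // row_mx_mul_basis ?size_companion_row //;
    last by rewrite (leq_trans (size_polyC_leq1 _)).
  (* Since [k < e] and [d > 0], the degree [k] is below [e + d - 1]: no multiple of [P * Q] is
     subtracted in the upper rows. *)
  rewrite coefXn gtn_eqF ?rmorph0 ?scale0r ?subr0; last first.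
    by rewrite -ltnS prednK // -[k.+2]addn1 leq_add.
  rewrite map_polyXn -exprSr skew_val_constM.
  by rewrite subrK.
rewrite /block_mx !rowKd row_row_mx row0 !rowK row_companion_n.
rewrite -[X in row_mx X](linear0 poly_rV).
rewrite semilinear_companion_n // row_mx_mul_basis ?size_poly0 //;
  last by rewrite size_companion_row.
rewrite add0r -skew_val_XM mulrA -exprS.
(* Reduction by [P * Q] happens exactly when [k + 1 = d], as does reduction by [P] in its companion
   matrix; hence [X^(k+1) Q - b P Q = (X^(k+1) - b P) Q] with the same [b]. *)
have -> : sigma (XQ k)`_(e + d).-1 = (k.+1 == d)%:R.
  have [kd|ne_id] := eqVneq k.+1 d.
    have <- : (e + k)%N = (e + d).-1 by rewrite -(congr1 (addn e) kd) addnS.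
    by rewrite lead_XQ rmorph1.
  rewrite nth_default ?rmorph0 // size_XQ -addnS -ltnS prednK //.
  by rewrite ltn_add2l ltn_neqAle ne_id ltn_ord.
congr poly_rV; set b := _%:R.
have -> : SkewPoly sigma ('X^(k.+1) - b *: skew_val P) =
    skew_X sigma ^+ k.+1 - skew_const sigma b * P.
  apply: skew_val_inj; rewrite skew_valD skew_val_Xn; congr (_ + _).
  by rewrite -skew_val_constM.
rewrite mulrBl -mulrA skew_valD -[X in _ = _ + X]/(- skew_val _).
by rewrite skew_val_constM.
Qed.

Lemma Psi_mul r : (forall x, iter r sigma x = x) ->
  Psi r (P * Q) = Psi r P * Psi r Q.
Proof.
move=> sigma_r; rewrite (Psi_twisted_norm r degP) (Psi_twisted_norm r degQ).
have degPQ : skew_deg (P * Q) = (e + d)%N.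
  by have [_ ->] := skew_monicM P_mon Q_mon; rewrite degP degQ addnC.
have := twisted_norm_conj r mul_basis_conj.
(* With [sigma^r = id], the semilinear base change becomes ordinary conjugation. *)
have -> : iter r (map_mx sigma) mul_basis = mul_basis.
  by apply/matrixP => i j; rewrite iter_map_mx.
rewrite (Psi_twisted_norm r degPQ) => /(char_poly_conj det_mul_basis) ->.
by rewrite char_poly_twisted_norm_ublock mulrC.
Qed.

End PsiMul.

Theorem proposition2p4p2 (p a r : nat) (L : finFieldType)
    (p_prime : prime p) (a_gt0 : (0 < a)%N) (r_gt0 : (0 < r)%N)
    (cardL : #|L| = ((p ^ a) ^ r)%N)
    (P Q : skew_poly (qfrob p_prime cardL)) :
  skew_monic P -> skew_nonconstant P ->
  skew_monic Q -> skew_nonconstant Q ->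
  Psi r (P * Q) = Psi r P * Psi r Q.
Proof.
move=> P_mon P_gt0 Q_mon _.
exact: (Psi_mul P_mon Q_mon erefl erefl P_gt0 (iter_qfrob p_prime cardL)).
Qed.
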